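(* Let $\mathfrak{L}$ be a left Leibniz algebra over a field $\mathbb{F}$. Then the category $\mathbf{mod}^{\mathrm{bi}}_{\mathrm{weak}}(\mathfrak{L})$ of finite-dimensional weak $\mathfrak{L}$-bimodules is a ring category over $\mathbb{F}$.
   Context: A left Leibniz algebra is an $\mathbb{F}$-vector space $\mathfrak{L}$ with a bilinear multiplication satisfying $x(yz)=(xy)z+y(xz)$ for all $x,y,z\in\mathfrak{L}$. A weak $\mathfrak{L}$-bimodule is an $\mathbb{F}$-vector space $M$ with bilinear left and right $\mathfrak{L}$-actions satisfying, for all $x,y\in\mathfrak{L}$, $m\in M$: (LLM) $(xy)\cdot m=x\cdot(y\cdot m)-y\cdot(x\cdot m)$ and (LML) $(x\cdot m)\cdot y=x\cdot(m\cdot y)-m\cdot(xy)$. Morphisms are $\mathbb{F}$-linear maps commuting with both actions. The monoidal structure is the tensor product $M\otimes N$ over $\mathbb{F}$ with actions $x\cdot(m\otimes n):=(x\cdot m)\otimes n+m\otimes(x\cdot n)$ and $(m\otimes n)\cdot x:=(m\cdot x)\otimes n+m\otimes(n\cdot x)$; the unit object is $\mathbb{F}$ with zero left and right actions; the associativity and unit constraints are those of the category of $\mathbb{F}$-vector spaces. A ring category over $\mathbb{F}$ (in the sense of Etingof, Gelaki, Nikshych and Ostrik) is a locally finite $\mathbb{F}$-linear abelian monoidal category (locally finite: all Hom spaces are finite-dimensional and all objects have finite length) whose tensor product bifunctor is $\mathbb{F}$-bilinear on morphisms and biexact (exact in both factors), and whose unit object $\mathbf{1}$ satisfies $\mathrm{End}(\mathbf{1})\cong\mathbb{F}$.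 *)

(* Defs.v *)
From HB Require Import structures.
From mathcomp Require Import all_boot all_order all_algebra.
From mathcomp Require Import boolp.

Set Implicit Arguments.
Unset Strict Implicit.
Unset Printing Implicit Defensive.

Import GRing.Theory.
Local Open Scope ring_scope.

(* Categories are given by their raw data, all axioms being collected in the
   predicate is_ring_category below. *)

Record cat_data (F : fieldType) := CatData {
  obj :> Type;
  mor : obj -> obj -> lmodType F;
  idm : forall X, mor X X;
  comp : forall X Y Z, mor Y Z -> mor X Y -> mor X Z
}.

Arguments mor {F c} X Y.
Arguments idm {F c} X.
Arguments comp {F c X Y Z} g f.

Notation "g \oc f" := (comp g f) (at level 40, left associativity).

Section Categories.
Variables (F : fieldType) (C : cat_data F).
Implicit Types X Y Z W : C.

Record is_category : Prop := IsCategory {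
  comp_idl : forall X Y (f : mor X Y), idm Y \oc f = f;
  comp_idr : forall X Y (f : mor X Y), f \oc idm X = f;
  comp_assoc : forall X Y Z W (h : mor Z W) (g : mor Y Z) (f : mor X Y),
    h \oc (g \oc f) = (h \oc g) \oc f
}.

Definition bilinear_comp : Prop := forall X Y Z,
  bilinear_for *:%R *:%R (fun (g : mor Y Z) (f : mor X Y) => g \oc f).

Definition iso X Y (f : mor X Y) : Prop :=
  exists g : mor Y X, g \oc f = idm X /\ f \oc g = idm Y.

Definition mono X Y (f : mor X Y) : Prop :=
  forall Z (g h : mor Z X), f \oc g = f \oc h -> g = h.

(* The morphism sets being pointed by 0, an object is both initial and
   terminal iff all morphisms from and to it vanish. *)
Definition zero_object X : Prop :=
  forall Y, (forall f : mor X Y, f = 0) /\ (forall f : mor Y X, f = 0).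

Definition biproduct X1 X2 Y : Prop :=
  exists (p1 : mor Y X1) (p2 : mor Y X2) (i1 : mor X1 Y) (i2 : mor X2 Y),
    [/\ p1 \oc i1 = idm X1, p2 \oc i2 = idm X2
      & i1 \oc p1 + i2 \oc p2 = idm Y].

Definition is_kernel K X Y (k : mor K X) (f : mor X Y) : Prop :=
  f \oc k = 0 /\
  forall Z (g : mor Z X), f \oc g = 0 -> exists! u : mor Z K, k \oc u = g.

Definition is_cokernel X Y Q (f : mor X Y) (c : mor Y Q) : Prop :=
  c \oc f = 0 /\
  forall Z (g : mor Y Z), g \oc f = 0 -> exists! u : mor Q Z, u \oc c = g.

Record is_linear_category : Prop := IsLinearCategory {
  lin_category : is_category;
  lin_comp : bilinear_comp;
  lin_zero : exists X, zero_object X;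
  lin_biproduct : forall X1 X2, exists Y, biproduct X1 X2 Y
}.

(* Every morphism has a canonical decomposition
   K --k--> X --i--> I --j--> Y --c--> Q. *)
Definition is_abelian : Prop := forall X Y (f : mor X Y),
  exists (K I Q : C) (k : mor K X) (i : mor X I) (j : mor I Y) (c : mor Y Q),
    [/\ j \oc i = f, is_kernel k f, is_cokernel f c,
        is_cokernel k i & is_kernel j c].

Definition short_exact X Y Z (f : mor X Y) (g : mor Y Z) : Prop :=
  is_kernel f g /\ is_cokernel f g.

Definition simple_object X : Prop :=
  ~ zero_object X /\
  forall Y (f : mor Y X), mono f -> zero_object Y \/ iso f.

(* Existence of a filtration 0 = X_0 <= ... <= X_n = X, X_(i+1) / X_i simple *)
Inductive finite_length : C -> Prop :=
| FiniteLength0 X : zero_object X -> finite_length X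
| FiniteLengthS X Y S (i : mor X Y) (p : mor Y S) :
    finite_length X -> short_exact i p -> simple_object S -> finite_length Y.

Definition finite_dimensional (V : lmodType F) : Prop :=
  exists n, inhabited (Vector.axiom n V).

Definition locally_finite : Prop :=
  (forall X Y, finite_dimensional (mor X Y)) /\ (forall X, finite_length X).

End Categories.

Record monoidal_data (F : fieldType) := MonoidalData {
  underlying_cat :> cat_data F;
  tob : underlying_cat -> underlying_cat -> underlying_cat;
  tmor : forall X X' Y Y' : underlying_cat,
    mor X X' -> mor Y Y' -> mor (tob X Y) (tob X' Y');
  tunit : underlying_cat;
  associator : forall X Y Z, mor (tob (tob X Y) Z) (tob X (tob Y Z));
  lunitor : forall X, mor (tob tunit X) X;
  runitor : forall X, mor (tob X tunit) X
}.

Arguments tob {F m} X Y.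
Arguments tmor {F m X X' Y Y'} f g.
Arguments tunit {F} m.
Arguments associator {F m} X Y Z.
Arguments lunitor {F m} X.
Arguments runitor {F m} X.

Section MonoidalCategories.
Variables (F : fieldType) (C : monoidal_data F).
Implicit Types X Y Z W : C.

Record is_monoidal : Prop := IsMonoidal {
  tmor_id : forall X Y, tmor (idm X) (idm Y) = idm (tob X Y);
  tmor_comp : forall X X' X'' Y Y' Y'' (f' : mor X' X'') (f : mor X X')
      (g' : mor Y' Y'') (g : mor Y Y'),
    tmor (f' \oc f) (g' \oc g) = tmor f' g' \oc tmor f g;
  associator_iso : forall X Y Z, iso (associator X Y Z);
  associator_natural : forall X X' Y Y' Z Z'
      (f : mor X X') (g : mor Y Y') (h : mor Z Z'),
    associator X' Y' Z' \oc tmor (tmor f g) h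
    = tmor f (tmor g h) \oc associator X Y Z;
  lunitor_iso : forall X, iso (lunitor X);
  lunitor_natural : forall X Y (f : mor X Y),
    lunitor Y \oc tmor (idm (tunit C)) f = f \oc lunitor X;
  runitor_iso : forall X, iso (runitor X);
  runitor_natural : forall X Y (f : mor X Y),
    runitor Y \oc tmor f (idm (tunit C)) = f \oc runitor X;
  pentagon : forall X Y Z W,
    associator X Y (tob Z W) \oc associator (tob X Y) Z W
    = tmor (idm X) (associator Y Z W) \oc associator X (tob Y Z) W
      \oc tmor (associator X Y Z) (idm W);
  triangle : forall X Y,
    tmor (idm X) (lunitor Y) \oc associator X (tunit C) Y
    = tmor (runitor X) (idm Y)
}.

Definition bilinear_tensor : Prop := forall X X' Y Y',
  bilinear_for *:%R *:%R (fun (f : mor X X') (g : mor Y Y') => tmor f g).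

Definition biexact_tensor : Prop :=
  forall (W X Y Z : C) (f : mor X Y) (g : mor Y Z), short_exact f g ->
    short_exact (tmor (idm W) f) (tmor (idm W) g) /\
    short_exact (tmor f (idm W)) (tmor g (idm W)).

(* End(1) is isomorphic to F as an F-algebra. *)
Definition unit_endo_trivial : Prop :=
  exists phi : mor (tunit C) (tunit C) -> F^o,
    [/\ linear phi, bijective phi, phi (idm (tunit C)) = 1
      & forall f g, phi (f \oc g) = phi f * phi g].

Record is_ring_category : Prop := IsRingCategory {
  ring_cat_linear : is_linear_category C;
  ring_cat_abelian : is_abelian C;
  ring_cat_locally_finite : locally_finite C;
  ring_cat_monoidal : is_monoidal;
  ring_cat_bilinear : bilinear_tensor;
  ring_cat_biexact : biexact_tensor;
  ring_cat_unit : unit_endo_trivial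
}.

End MonoidalCategories.

HB.mixin Record isLeibniz (F : fieldType) L of GRing.Lmodule F L := {
  leibmul : L -> L -> L;
  leibmul_bilinear : bilinear_for *:%R *:%R leibmul;
  leibmul_leibniz : forall x y z : L,
    leibmul x (leibmul y z) = leibmul (leibmul x y) z + leibmul y (leibmul x z)
}.

#[short(type="leibnizType")]
HB.structure Definition Leibniz (F : fieldType) :=
  {L of GRing.Lmodule F L & isLeibniz F L}.

(* Vector makes weak bimodules finite-dimensional; L may have any dimension. *)

HB.mixin Record isWeakBimod (F : fieldType) (L : leibnizType F) M
    of Vector F M := {
  lact : L -> M -> M;
  ract : M -> L -> M;
  lact_bilinear : bilinear_for *:%R *:%R lact;
  ract_bilinear : bilinear_for *:%R *:%R ract;
  lact_LLM : forall (x y : L) (m : M),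
    lact (leibmul x y) m = lact x (lact y m) - lact y (lact x m);
  ract_LML : forall (x y : L) (m : M),
    ract (lact x m) y = lact x (ract m y) - ract m (leibmul x y)
}.

#[short(type="wbimodType")]
HB.structure Definition WeakBimod (F : fieldType) (L : leibnizType F) :=
  {M of Vector F M & isWeakBimod F L M}.

HB.instance Definition _ (F : fieldType) (L : leibnizType F)
    (M : wbimodType L) :=
  bilinear_isBilinear.Build F L M M *:%R *:%R lact lact_bilinear.
HB.instance Definition _ (F : fieldType) (L : leibnizType F)
    (M : wbimodType L) :=
  bilinear_isBilinear.Build F M L M *:%R *:%R ract ract_bilinear.

Section Morphisms.
Variables (F : fieldType) (L : leibnizType F).

Definition is_bimod_morphism (M N : wbimodType L) (f : 'Hom(M, N)) : Prop :=
  (forall (x : L) (m : M), f (lact x m) = lact x (f m)) /\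
  (forall (x : L) (m : M), f (ract m x) = ract (f m) x).

Definition bimod_morphism (M N : wbimodType L) : {pred 'Hom(M, N)} :=
  fun f => `[< is_bimod_morphism f >].

Lemma bimod_morphismP (M N : wbimodType L) (f : 'Hom(M, N)) :
  reflect (is_bimod_morphism f) (f \in @bimod_morphism M N).
Proof. exact: asboolP. Qed.

Lemma bimod_morphism_submod_closed (M N : wbimodType L) :
  submod_closed (@bimod_morphism M N).
Proof.
split.
  by apply/bimod_morphismP; split=> x m; rewrite !lfunE /= ?linear0r ?linear0l.
move=> a f g /bimod_morphismP[fl fr] /bimod_morphismP[gl gr].
apply/bimod_morphismP; split=> x m; rewrite !lfunE /= !lfunE /=.
  by rewrite fl gl linearPr.
by rewrite fr gr linearPl.
Qed.

HB.instance Definition _ (M N : wbimodType L) :=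
  GRing.isSubmodClosed.Build F 'Hom(M, N) (@bimod_morphism M N)
    (@bimod_morphism_submod_closed M N).

Record bimod_hom (M N : wbimodType L) := BimodHom {
  bimod_lfun :> 'Hom(M, N);
  bimod_homP : bimod_lfun \in @bimod_morphism M N
}.

HB.instance Definition _ (M N : wbimodType L) :=
  [isSub of bimod_hom M N for @bimod_lfun M N].
HB.instance Definition _ (M N : wbimodType L) :=
  [Choice of bimod_hom M N by <:].
HB.instance Definition _ (M N : wbimodType L) :=
  [SubChoice_isSubLmodule of bimod_hom M N by <:].

Definition mk_hom (M N : wbimodType L) (f : 'Hom(M, N))
    (fP : is_bimod_morphism f) : bimod_hom M N :=
  BimodHom (introT (bimod_morphismP f) fP).

Lemma bimod_hom_lact (M N : wbimodType L) (f : bimod_hom M N) x m :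
  bimod_lfun f (lact x m) = lact x (bimod_lfun f m).
Proof. by have /bimod_morphismP[fl _] := bimod_homP f. Qed.

Lemma bimod_hom_ract (M N : wbimodType L) (f : bimod_hom M N) m x :
  bimod_lfun f (ract m x) = ract (bimod_lfun f m) x.
Proof. by have /bimod_morphismP[_ fr] := bimod_homP f. Qed.

Lemma id_is_bimod_morphism (M : wbimodType L) :
  is_bimod_morphism (\1%VF : 'Hom(M, M)).
Proof. by split=> x m; rewrite !lfunE. Qed.

Lemma comp_is_bimod_morphism (M N P : wbimodType L)
    (g : bimod_hom N P) (f : bimod_hom M N) :
  is_bimod_morphism (bimod_lfun g \o bimod_lfun f)%VF.
Proof.
by split=> x m; rewrite !lfunE /= ?bimod_hom_lact ?bimod_hom_ract.
Qed.

Definition wbimod_cat : cat_data F :=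
  @CatData F (wbimodType L) (fun M N => bimod_hom M N)
    (fun M => mk_hom (id_is_bimod_morphism M))
    (fun M N P g f => mk_hom (comp_is_bimod_morphism g f)).

End Morphisms.

(* Tensor products of finite-dimensional vector spaces: V (x) W is realized as
   the space of matrices of coordinates in the bases vbasis {:V}, vbasis {:W};
   see tens_lift_bilinear and tens_ext for the universal property. *)

Section TensorSpace.
Variable F : fieldType.

Lemma linear_lfun (V W : vectType F) (f : V -> W) :
  linear f -> exists h : 'Hom(V, W), h =1 f.
Proof.
move=> lf; pose g : {linear V -> W} :=
  HB.pack f (GRing.isLinear.Build F _ _ *:%R f lf).
by exists (linfun g) => v; rewrite lfunE.
Qed.

Definition tensor (V W : vectType F) : Type :=
  'M[F]_(\dim {:V}, \dim {:W}).

HB.instance Definition _ (V W : vectType F) := Vector.on (tensor V W).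

Section Pure.
Variables V W : vectType F.

Definition tens (v : V) (w : W) : tensor V W :=
  \matrix_(i, j) (coord (vbasis {:V}) i v * coord (vbasis {:W}) j w).

Lemma tens_bilinear : bilinear_for *:%R *:%R tens.
Proof.
split=> u a v w; apply/matrixP=> i j; rewrite !mxE linearP /=.
  by rewrite mulrDl mulrA.
by rewrite mulrDr mulrCA.
Qed.

HB.instance Definition _ :=
  bilinear_isBilinear.Build F V W (tensor V W) *:%R *:%R tens tens_bilinear.

Variable U : vectType F.

Definition tens_lift_fun (b : V -> W -> U) (t : tensor V W) : U :=
  \sum_i \sum_j t i j *: b (vbasis {:V})`_i (vbasis {:W})`_j.

Lemma tens_lift_fun_linear (b : V -> W -> U) : linear (tens_lift_fun b).
Proof.
move=> a s t; rewrite /tens_lift_fun scaler_sumr -big_split; apply: eq_bigr => i _.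
rewrite scaler_sumr -big_split; apply: eq_bigr => j _.
by rewrite !mxE scalerDl scalerA.
Qed.

HB.instance Definition _ (b : V -> W -> U) :=
  GRing.isLinear.Build F (tensor V W) U *:%R (tens_lift_fun b)
    (tens_lift_fun_linear b).

Definition tens_lift (b : V -> W -> U) : 'Hom(tensor V W, U) :=
  linfun (tens_lift_fun b).

Lemma tens_lift_bilinear (b : V -> W -> U) (v : V) (w : W) :
  bilinear_for *:%R *:%R b -> tens_lift b (tens v w) = b v w.
Proof.
move=> [bl br]; rewrite lfunE /= /tens_lift_fun.
pose Bl w' : {linear V -> U} :=
  HB.pack (b ^~ w') (GRing.isLinear.Build F V U *:%R (b ^~ w') (bl w')).
pose Br v' : {linear W -> U} :=
  HB.pack (b v') (GRing.isLinear.Build F W U *:%R (b v') (br v')).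
rewrite [in RHS](coord_vbasis (memvf v)) -[RHS]/(Bl w _) linear_sum /=.
apply: eq_bigr => i _; rewrite -[RHS]/(Bl w _) linearZ /=.
rewrite [in RHS](coord_vbasis (memvf w)) -[X in _ = _ *: X]/(Br _ _) linear_sum.
rewrite scaler_sumr; apply: eq_bigr => j _.
by rewrite linearZ /= scalerA mxE.
Qed.

Lemma tens_ext (f g : 'Hom(tensor V W, U)) :
  (forall v w, f (tens v w) = g (tens v w)) -> f = g.
Proof.
move=> fg; apply/lfunP=> t.
suff -> : t = \sum_i \sum_j t i j *: tens (vbasis {:V})`_i (vbasis {:W})`_j.
  rewrite !linear_sum; apply: eq_bigr => i _.
  by rewrite !linear_sum; apply: eq_bigr => j _; rewrite !linearZ /= fg.
rewrite [LHS]matrix_sum_delta; apply: eq_bigr => i _; apply: eq_bigr => j _.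
congr (_ *: _); apply/matrixP=> k l; rewrite !mxE.
have fV := basis_free (vbasisP {:V}); have fW := basis_free (vbasisP {:W}).
rewrite (coord_free i k fV) (coord_free j l fW) -natrM mulnb.
by rewrite ![_ == i]eq_sym ![_ == j]eq_sym.
Qed.

End Pure.

Lemma tens_ext3 (V W X U : vectType F)
    (f g : 'Hom(tensor (tensor V W) X, U)) :
  (forall v w x, f (tens (tens v w) x) = g (tens (tens v w) x)) -> f = g.
Proof.
move=> fg; apply: tens_ext => t x.
have lin : linear (fun s : tensor V W => tens s x).
  by move=> a s s'; rewrite linearPl.
have [tl tlE] := linear_lfun lin.
suff /lfunP/(_ t): (f \o tl)%VF = (g \o tl)%VF by rewrite !comp_lfunE tlE.
by apply: tens_ext => v w; rewrite !comp_lfunE tlE fg.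
Qed.

Definition tens_map (V V' W W' : vectType F) (f : 'Hom(V, V'))
    (g : 'Hom(W, W')) : 'Hom(tensor V W, tensor V' W') :=
  tens_lift (fun v w => tens (f v) (g w)).

Lemma tens_mapE (V V' W W' : vectType F) (f : 'Hom(V, V')) (g : 'Hom(W, W'))
  v w : tens_map f g (tens v w) = tens (f v) (g w).
Proof.
rewrite /tens_map tens_lift_bilinear //; split=> [w'|v'] a x y.
  by rewrite linearP linearPl.
by rewrite linearP linearPr.
Qed.

Definition tens_assoc (V W X : vectType F) :
    'Hom(tensor (tensor V W) X, tensor V (tensor W X)) :=
  tens_lift (fun t x => tens_lift (fun v w => tens v (tens w x)) t).

Lemma tens_assocE (V W X : vectType F) (v : V) (w : W) (x : X) :
  tens_assoc V W X (tens (tens v w) x) = tens v (tens w x).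
Proof.
have inner (y : X) : bilinear_for *:%R *:%R (fun (v : V) (w : W) => tens v (tens w y)).
  by split=> [w'|v'] a z z'; rewrite !(linearPl, linearPr).
rewrite /tens_assoc tens_lift_bilinear; first by rewrite tens_lift_bilinear.
split=> [x'|t'] a z z'; first by rewrite linearP.
pose h (y : X) := tens_lift (fun (v : V) (w : W) => tens v (tens w y)).
suff /lfunP/(_ t'): h (a *: z + z') = a *: h z + h z'.
  by rewrite add_lfunE scale_lfunE.
apply: tens_ext => v' w'; rewrite add_lfunE scale_lfunE /h.
by rewrite !tens_lift_bilinear // !linearPr.
Qed.

Definition tens_lunit (V : vectType F) : 'Hom(tensor F^o V, V) :=
  tens_lift (fun (a : F^o) v => a *: v).

Lemma tens_lunitE (V : vectType F) (a : F^o) (v : V) :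
  tens_lunit V (tens a v) = a *: v.
Proof.
rewrite /tens_lunit tens_lift_bilinear //; split=> [v'|a'] b x y.
  by rewrite scalerDl /= scalerA.
by rewrite linearP.
Qed.

Definition tens_runit (V : vectType F) : 'Hom(tensor V F^o, V) :=
  tens_lift (fun v (a : F^o) => a *: v).

Lemma tens_runitE (V : vectType F) (v : V) (a : F^o) :
  tens_runit V (tens v a) = a *: v.
Proof.
rewrite /tens_runit tens_lift_bilinear //; split=> [a'|v'] b x y.
  by rewrite linearP.
by rewrite scalerDl /= scalerA.
Qed.

End TensorSpace.

Section TensorBimodule.
Variables (F : fieldType) (L : leibnizType F).

Section Objects.
Variables M N : wbimodType L.

Definition tens_lact_lfun (x : L) : 'End(tensor M N) :=
  tens_lift (fun m n => tens (lact x m) n + tens m (lact x n)).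

Definition tens_ract_lfun (x : L) : 'End(tensor M N) :=
  tens_lift (fun m n => tens (ract m x) n + tens m (ract n x)).

Definition tens_lact (x : L) (t : tensor M N) : tensor M N :=
  tens_lact_lfun x t.

Definition tens_ract (t : tensor M N) (x : L) : tensor M N :=
  tens_ract_lfun x t.

Lemma tens_lact_lfunE (x : L) (m : M) (n : N) :
  tens_lact_lfun x (tens m n) = tens (lact x m) n + tens m (lact x n).
Proof.
rewrite /tens_lact_lfun tens_lift_bilinear //; split=> [n'|m'] a u v.
  by rewrite !(linearPl, linearPr) /= scalerDr addrACA.
by rewrite !(linearPl, linearPr) /= scalerDr addrACA.
Qed.

Lemma tens_ract_lfunE (x : L) (m : M) (n : N) :
  tens_ract_lfun x (tens m n) = tens (ract m x) n + tens m (ract n x).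
Proof.
rewrite /tens_ract_lfun tens_lift_bilinear //; split=> [n'|m'] a u v.
  by rewrite !(linearPl, linearPr) /= scalerDr addrACA.
by rewrite !(linearPl, linearPr) /= scalerDr addrACA.
Qed.

Lemma tens_lact_bilinear : bilinear_for *:%R *:%R tens_lact.
Proof.
split=> [t a x y|x]; last exact: linearP.
suff /lfunP/(_ t): tens_lact_lfun (a *: x + y)
    = a *: tens_lact_lfun x + tens_lact_lfun y.
  by rewrite add_lfunE scale_lfunE.
apply: tens_ext => m n; rewrite add_lfunE scale_lfunE !tens_lact_lfunE.
by rewrite !(linearPl, linearPr) /= scalerDr addrACA.
Qed.

Lemma tens_ract_bilinear : bilinear_for *:%R *:%R tens_ract.
Proof.
split=> [x|t a x y]; first exact: linearP.
suff /lfunP/(_ t): tens_ract_lfun (a *: x + y)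
    = a *: tens_ract_lfun x + tens_ract_lfun y.
  by rewrite add_lfunE scale_lfunE.
apply: tens_ext => m n; rewrite add_lfunE scale_lfunE !tens_ract_lfunE.
by rewrite !(linearPl, linearPr) /= scalerDr addrACA.
Qed.

Lemma tens_lact_LLM (x y : L) (t : tensor M N) :
  tens_lact (leibmul x y) t
  = tens_lact x (tens_lact y t) - tens_lact y (tens_lact x t).
Proof.
suff /lfunP/(_ t): tens_lact_lfun (leibmul x y)
    = (tens_lact_lfun x \o tens_lact_lfun y)%VF
      - (tens_lact_lfun y \o tens_lact_lfun x)%VF.
  by rewrite add_lfunE opp_lfunE !comp_lfunE.
apply: tens_ext => m n; rewrite add_lfunE opp_lfunE !comp_lfunE.
rewrite !tens_lact_lfunE !linearD /= !tens_lact_lfunE !lact_LLM.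
rewrite !(linearBl, linearBr) /=.
rewrite !opprD [RHS](AC ((2*2)*(2*2)) ((1*5)*(4*8)*((2*7)*(3*6)))) /=.
by rewrite !subrr !addr0.
Qed.

Lemma tens_ract_LML (x y : L) (t : tensor M N) :
  tens_ract (tens_lact x t) y
  = tens_lact x (tens_ract t y) - tens_ract t (leibmul x y).
Proof.
suff /lfunP/(_ t): (tens_ract_lfun y \o tens_lact_lfun x)%VF
    = (tens_lact_lfun x \o tens_ract_lfun y)%VF
      - tens_ract_lfun (leibmul x y).
  by rewrite add_lfunE opp_lfunE !comp_lfunE.
apply: tens_ext => m n; rewrite add_lfunE opp_lfunE !comp_lfunE.
rewrite !(tens_lact_lfunE, tens_ract_lfunE) !linearD /=.
rewrite !(tens_lact_lfunE, tens_ract_lfunE) !ract_LML.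
rewrite !(linearBl, linearBr) /=.
by rewrite [LHS](AC (2*1*(1*2)) ((1*4*(3*5))*(2*6))).
Qed.

HB.instance Definition _ := isWeakBimod.Build F L (tensor M N)
  tens_lact_bilinear tens_ract_bilinear tens_lact_LLM tens_ract_LML.

Lemma lact_tens (x : L) (m : M) (n : N) :
  lact x (tens m n) = tens (lact x m) n + tens m (lact x n).
Proof. exact: tens_lact_lfunE. Qed.

Lemma ract_tens (x : L) (m : M) (n : N) :
  ract (tens m n) x = tens (ract m x) n + tens m (ract n x).
Proof. exact: tens_ract_lfunE. Qed.

End Objects.

Definition unit_bimod (_ : leibnizType F) : Type := F^o.

HB.instance Definition _ := Vector.on (unit_bimod L).

Definition unit_lact (x : L) (a : unit_bimod L) : unit_bimod L := 0.
Definition unit_ract (a : unit_bimod L) (x : L) : unit_bimod L := 0.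

Lemma unit_lact_bilinear : bilinear_for *:%R *:%R unit_lact.
Proof. by split=> [a b x y|x b u v]; rewrite /unit_lact /= scaler0 addr0. Qed.

Lemma unit_ract_bilinear : bilinear_for *:%R *:%R unit_ract.
Proof. by split=> [a b x y|x b u v]; rewrite /unit_ract /= scaler0 addr0. Qed.

Lemma unit_lact_LLM (x y : L) (a : unit_bimod L) :
  unit_lact (leibmul x y) a
  = unit_lact x (unit_lact y a) - unit_lact y (unit_lact x a).
Proof. by rewrite /unit_lact subr0. Qed.

Lemma unit_ract_LML (x y : L) (a : unit_bimod L) :
  unit_ract (unit_lact x a) y
  = unit_lact x (unit_ract a y) - unit_ract a (leibmul x y).
Proof. by rewrite /unit_lact /unit_ract subr0. Qed.

HB.instance Definition _ := isWeakBimod.Build F L (unit_bimod L)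
  unit_lact_bilinear unit_ract_bilinear unit_lact_LLM unit_ract_LML.

Lemma tens_map_is_bimod_morphism (M M' N N' : wbimodType L)
    (f : bimod_hom M M') (g : bimod_hom N N') :
  is_bimod_morphism (tens_map (bimod_lfun f) (bimod_lfun g)
    : 'Hom(tensor M N, tensor M' N')).
Proof.
split=> x t.
  suff /lfunP/(_ t): (tens_map (bimod_lfun f) (bimod_lfun g)
        \o tens_lact_lfun M N x)%VF
      = (tens_lact_lfun M' N' x
        \o tens_map (bimod_lfun f) (bimod_lfun g))%VF.
    by rewrite !comp_lfunE.
  apply: tens_ext => m n; rewrite !comp_lfunE.
  by rewrite !(tens_lact_lfunE, tens_mapE) linearD /= !tens_mapE !bimod_hom_lact.
suff /lfunP/(_ t): (tens_map (bimod_lfun f) (bimod_lfun g)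
      \o tens_ract_lfun M N x)%VF
    = (tens_ract_lfun M' N' x
      \o tens_map (bimod_lfun f) (bimod_lfun g))%VF.
  by rewrite !comp_lfunE.
apply: tens_ext => m n; rewrite !comp_lfunE.
by rewrite !(tens_ract_lfunE, tens_mapE) linearD /= !tens_mapE !bimod_hom_ract.
Qed.

Lemma tens_assoc_is_bimod_morphism (M N P : wbimodType L) :
  is_bimod_morphism (tens_assoc M N P
    : 'Hom(tensor (tensor M N) P, tensor M (tensor N P))).
Proof.
split=> x t.
  suff /lfunP/(_ t): (tens_assoc M N P \o tens_lact_lfun (tensor M N) P x)%VF
      = (tens_lact_lfun M (tensor N P) x \o tens_assoc M N P)%VF.
    by rewrite !comp_lfunE.
  apply: tens_ext3 => m n p; rewrite !comp_lfunE.
  rewrite tens_assocE !tens_lact_lfunE !lact_tens !(linearDl, linearDr, linearD) /=.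
  by rewrite !tens_assocE addrA.
suff /lfunP/(_ t): (tens_assoc M N P \o tens_ract_lfun (tensor M N) P x)%VF
    = (tens_ract_lfun M (tensor N P) x \o tens_assoc M N P)%VF.
  by rewrite !comp_lfunE.
apply: tens_ext3 => m n p; rewrite !comp_lfunE.
rewrite tens_assocE !tens_ract_lfunE !ract_tens !(linearDl, linearDr, linearD) /=.
by rewrite !tens_assocE addrA.
Qed.

Lemma tens_lunit_is_bimod_morphism (M : wbimodType L) :
  is_bimod_morphism (tens_lunit M : 'Hom(tensor (unit_bimod L) M, M)).
Proof.
split=> x t.
  have [h lE] := linear_lfun (lact_bilinear.2 x : linear (lact x : M -> M)).
  suff /lfunP/(_ t): (tens_lunit M \o tens_lact_lfun (unit_bimod L) M x)%VF
      = (h \o tens_lunit M)%VF.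
    by rewrite !comp_lfunE lE.
  apply: (@tens_ext F (unit_bimod L) M M) => m n; rewrite !comp_lfunE lE.
    by rewrite tens_lact_lfunE linear0l add0r !tens_lunitE linearZr_LR.
have [h lE] := linear_lfun (ract_bilinear.1 x : linear (ract ^~ x : M -> M)).
suff /lfunP/(_ t): (tens_lunit M \o tens_ract_lfun (unit_bimod L) M x)%VF
    = (h \o tens_lunit M)%VF.
  by rewrite !comp_lfunE lE.
apply: (@tens_ext F (unit_bimod L) M M) => m n; rewrite !comp_lfunE lE.
by rewrite tens_ract_lfunE linear0l add0r !tens_lunitE linearZl_LR.
Qed.

Lemma tens_runit_is_bimod_morphism (M : wbimodType L) :
  is_bimod_morphism (tens_runit M : 'Hom(tensor M (unit_bimod L), M)).
Proof.
split=> x t.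
  have [h lE] := linear_lfun (lact_bilinear.2 x : linear (lact x : M -> M)).
  suff /lfunP/(_ t): (tens_runit M \o tens_lact_lfun M (unit_bimod L) x)%VF
      = (h \o tens_runit M)%VF.
    by rewrite !comp_lfunE lE.
  apply: (@tens_ext F M (unit_bimod L) M) => m n; rewrite !comp_lfunE lE.
    by rewrite tens_lact_lfunE linear0r addr0 !tens_runitE linearZr_LR.
have [h lE] := linear_lfun (ract_bilinear.1 x : linear (ract ^~ x : M -> M)).
suff /lfunP/(_ t): (tens_runit M \o tens_ract_lfun M (unit_bimod L) x)%VF
    = (h \o tens_runit M)%VF.
  by rewrite !comp_lfunE lE.
apply: (@tens_ext F M (unit_bimod L) M) => m n; rewrite !comp_lfunE lE.
by rewrite tens_ract_lfunE linear0r addr0 !tens_runitE linearZl_LR.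
Qed.

Definition wbimod_monoidal : monoidal_data F :=
  @MonoidalData F (wbimod_cat L)
    (fun M N : wbimodType L => tensor M N : wbimodType L)
    (fun M M' N N' f g => mk_hom (tens_map_is_bimod_morphism f g))
    (unit_bimod L : wbimodType L)
    (fun M N P => mk_hom (tens_assoc_is_bimod_morphism M N P))
    (fun M => mk_hom (tens_lunit_is_bimod_morphism M))
    (fun M => mk_hom (tens_runit_is_bimod_morphism M)).

End TensorBimodule.

(* Main.v *)
Require Import Defs.
From HB Require Import structures.
From mathcomp Require Import all_boot all_order all_algebra.
From mathcomp Require Import boolp.
Import Defs.

Set Implicit Arguments.
Unset Strict Implicit.
Unset Printing Implicit Defensive.

Import GRing.Theory VectorInternalTheory.
Local Open Scope ring_scope.

(* Kernels and cokernels are those of vector spaces, because kernels and images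
   of bimodule morphisms are stable under both actions, so exactness in the
   category is exactness of the underlying linear maps. Hence a composition
   series comes from a maximal proper stable subspace by induction on the
   dimension, and biexactness holds because an exact sequence of vector spaces
   splits and the functors W (x) - and - (x) W preserve a linear splitting. *)

(** * Sub-bimodules, and kernels and cokernels of bimodule morphisms *)

Section Bimodules.
Variables (F : fieldType) (L : leibnizType F).
Implicit Types M N K X Y Z Q : wbimodType L.
Local Notation C := (wbimod_cat L).

Lemma bimod_hom_ext M N (f g : bimod_hom M N) :
  (forall m, bimod_lfun f m = bimod_lfun g m) -> f = g.
Proof. by move=> fg; apply/val_inj/lfunP. Qed.

Lemma bimod_hom0E M N m : bimod_lfun (0 : bimod_hom M N) m = 0.
Proof. by rewrite lfunE. Qed.

Lemma bimod_homPE M N a (f g : bimod_hom M N) m :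
  bimod_lfun (a *: f + g) m = a *: bimod_lfun f m + bimod_lfun g m.
Proof. by rewrite lfunE /= lfunE. Qed.

Lemma comp_homE M N K (g : bimod_hom N K) (f : bimod_hom M N) m :
  bimod_lfun (@comp F C M N K g f) m = bimod_lfun g (bimod_lfun f m).
Proof. exact: comp_lfunE. Qed.

Lemma id_homE M m : bimod_lfun (@idm F C M) m = m.
Proof. exact: id_lfunE. Qed.

(** These are the sub-bimodules, kept as bare subspaces so that the inclusion order and the
    dimension of [{vspace M}] apply to them. *)
Definition stable M (U : {vspace M}) : Prop :=
  forall x m, m \in U -> lact x m \in U /\ ract m x \in U.

Lemma lker_stable M N (f : bimod_hom M N) : stable (lker f).
Proof.
move=> x m; rewrite !memv_ker => /eqP fm.
by rewrite bimod_hom_lact bimod_hom_ract fm linear0l linear0r eqxx.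
Qed.

Lemma limg_stable M N (f : bimod_hom M N) : stable (limg f).
Proof.
move=> x n /memv_imgP[m _ ->]; split.
  by rewrite -bimod_hom_lact memv_img ?memvf.
by rewrite -bimod_hom_ract memv_img ?memvf.
Qed.

Lemma lpreim_stable M N (f : bimod_hom M N) (U : {vspace N}) :
  stable U -> stable (f @^-1: U).
Proof.
move=> sU x m; rewrite -!memv_preim bimod_hom_lact bimod_hom_ract.
exact: sU.
Qed.

Arguments lker_stable {M N} f.
Arguments limg_stable {M N} f.
Arguments lpreim_stable {M N} f {U}.

(** * Sub-bimodules and quotients as bimodules, with actions transported along linear maps *)

Section Retract.
Variables (M : wbimodType L) (V : vectType F).
Variables (i : 'Hom(V, M)) (p : 'Hom(M, V)).

Definition retract_lact (x : L) (v : V) : V := p (lact x (i v)).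
Definition retract_ract (v : V) (x : L) : V := p (ract (i v) x).

(* These hold for a subobject, where i (p m) = m on the image of i, and for a
   quotient, where p (x . i (p m)) = p (x . m). *)
Hypothesis pLL : forall x y v,
  p (lact x (i (p (lact y (i v))))) = p (lact x (lact y (i v))).
Hypothesis pLR : forall x y v,
  p (lact x (i (p (ract (i v) y)))) = p (lact x (ract (i v) y)).
Hypothesis pRL : forall x y v,
  p (ract (i (p (lact x (i v)))) y) = p (ract (lact x (i v)) y).

Lemma retract_lact_bilinear : bilinear_for *:%R *:%R retract_lact.
Proof.
split=> [v|x] a u w; first by rewrite /retract_lact linearPl linearP.
by rewrite /retract_lact linearP linearPr linearP.
Qed.

Lemma retract_ract_bilinear : bilinear_for *:%R *:%R retract_ract.
Proof.
split=> [x|v] a u w; first by rewrite /retract_ract linearP linearPl linearP.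
by rewrite /retract_ract linearPr linearP.
Qed.

Lemma retract_LLM (x y : L) (v : V) :
  retract_lact (leibmul x y) v
  = retract_lact x (retract_lact y v) - retract_lact y (retract_lact x v).
Proof. by rewrite /retract_lact !pLL lact_LLM linearB. Qed.

Lemma retract_LML (x y : L) (v : V) :
  retract_ract (retract_lact x v) y
  = retract_lact x (retract_ract v y) - retract_ract v (leibmul x y).
Proof. by rewrite /retract_ract /retract_lact pLR pRL ract_LML linearB. Qed.

Definition retract_bimod : wbimodType L := HB.pack V
  (isWeakBimod.Build F L V retract_lact_bilinear retract_ract_bilinear
     retract_LLM retract_LML).

End Retract.

(** The actions are restricted along the inclusion [i] and a linear projection [p] onto [U].
    Stability keeps every intermediate value in [U], where [i \o p] is the identity, so [p] need not
    commute with the actions. *)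
Lemma stable_sub M (U : {vspace M}) : stable U ->
  exists (K : wbimodType L) (k : bimod_hom K M), lker k = 0%VS /\ limg k = U.
Proof.
move=> sU; pose i := linfun (@vsval _ _ U); pose p := linfun (vsproj U).
have iE u : i u = vsval u by rewrite lfunE.
have iK m : m \in U -> i (p m) = m by move=> mU; rewrite !lfunE /= vsprojK.
have lU x u : lact x (i u) \in U by rewrite iE; case: (sU x _ (subvsP u)).
have rU x u : ract (i u) x \in U by rewrite iE; case: (sU x _ (subvsP u)).
have pLL x y u : p (lact x (i (p (lact y (i u))))) = p (lact x (lact y (i u))).
  by rewrite iK.
have pLR x y u : p (lact x (i (p (ract (i u) y)))) = p (lact x (ract (i u) y)).
  by rewrite iK.
have pRL x y u : p (ract (i (p (lact x (i u)))) y) = p (ract (lact x (i u)) y).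
  by rewrite iK.
pose K := retract_bimod pLL pLR pRL.
have iP : @is_bimod_morphism F L K M i by split=> x u; exact: iK.
exists K, (mk_hom iP) => /=; split.
  apply/eqP; rewrite -subv0; apply/subvP=> u; rewrite memv_ker iE memv0.
  by move=> /eqP u0; apply/eqP/val_inj.
apply/vspaceP=> m; apply/memv_imgP/idP => [[u _ ->]|mU].
  by rewrite iE subvsP.
by exists (p m); rewrite ?memvf ?iK.
Qed.

(** The quotient is carried by a linear complement of [U], the image of the idempotent [e] with
    kernel [U]. The map [p] identifies vectors congruent modulo [U], and stability of [U] makes the
    transported actions independent of representatives. *)
Lemma stable_quotient M (U : {vspace M}) : stable U ->
  exists (Q : wbimodType L) (q : bimod_hom M Q),
    limg q = fullv /\ lker q = U.
Proof.
move=> sU; pose e : 'End(M) := (\1 - projv U)%VF.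
have eE m : e m = m - projv U m by rewrite add_lfunE opp_lfunE id_lfunE.
have eU m : (e m == 0) = (m \in U).
  rewrite eE subr_eq0; apply/eqP/idP => [->|mU]; first exact: memv_proj.
  by rewrite projv_id.
have ee m : e (e m) = e m.
  apply/eqP; rewrite -subr_eq0 -linearB eU [e m]eE.
  by rewrite addrAC subrr add0r memvN memv_proj.
pose i := linfun (@vsval _ _ (limg e)).
pose p := (linfun (vsproj (limg e)) \o e)%VF.
have iE u : i u = vsval u by rewrite lfunE.
have ip m : i (p m) = e m.
  by rewrite iE comp_lfunE [X in vsval X]lfunE /= vsprojK // memv_img ?memvf.
have i_inj : injective i by move=> u v; rewrite !iE => /val_inj.
have ei u : e (i u) = i u.
  by rewrite iE; case/memv_imgP: (subvsP u) => m _ ->.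
have pU m n : m - n \in U -> p m = p n.
  by rewrite -eU linearB subr_eq0 => /eqP emn; apply: i_inj; rewrite !ip.
have emU m : e m - m \in U by rewrite -eU linearB /= ee subrr.
have pl x m : p (lact x (i (p m))) = p (lact x m).
  by apply: pU; rewrite ip -linearBr; case: (sU x _ (emU m)).
have pr x m : p (ract (i (p m)) x) = p (ract m x).
  by apply: pU; rewrite ip -linearBl; case: (sU x _ (emU m)).
pose Q := retract_bimod (fun x y u => pl x _) (fun x y u => pl x _)
            (fun x y u => pr y (lact x (i u))).
have pP : @is_bimod_morphism F L M Q p.
  by split=> x m; [rewrite -pl | rewrite -pr].
exists Q, (mk_hom pP) => /=; split; apply/vspaceP=> m.
  rewrite memvf; apply/memv_imgP; exists (i m); rewrite ?memvf //.
  by apply: i_inj; rewrite ip ei.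
by rewrite memv_ker -eU -(inj_eq i_inj) ip linear0.
Qed.

(** The linear factor [k^-1 \o g] commutes with the actions because this can be checked after
    applying the injective morphism [k]. *)
Lemma lift_mono K X Z (k : bimod_hom K X) (g : bimod_hom Z X) :
  lker k = 0%VS -> (limg g <= limg k)%VS ->
  exists u : bimod_hom Z K, (k : mor (c := C) K X) \oc u = g.
Proof.
move=> k0 gk; have kK z : k (k^-1 (g z))%VF = g z.
  by apply: limg_lfunVK; apply: (subvP gk); rewrite memv_img ?memvf.
have k_inj : injective k by apply/lker0P/eqP.
have uP : is_bimod_morphism (k^-1 \o g)%VF.
  split=> x m; apply: k_inj; rewrite !comp_lfunE.
    by rewrite kK !bimod_hom_lact kK.
  by rewrite kK !bimod_hom_ract kK.
exists (mk_hom uP); apply: bimod_hom_ext => z.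
by rewrite comp_homE comp_lfunE kK.
Qed.

(** The section [q^-1] of [q] is only linear, but [y] and [q^-1 (q y)] differ by an element of
    [lker q], which [g] kills; hence [g \o q^-1] commutes with the actions. *)
Lemma lift_epi Y Q Z (q : bimod_hom Y Q) (g : bimod_hom Y Z) :
  limg q = fullv -> (lker q <= lker g)%VS ->
  exists u : bimod_hom Q Z, (u : mor (c := C) Q Z) \oc q = g.
Proof.
move=> qf qg.
have qK z : q (q^-1%VF z) = z by apply: limg_lfunVK; rewrite qf memvf.
have gK y : g (q^-1%VF (q y)) = g y.
  apply/eqP; rewrite -subr_eq0 -linearB -memv_ker.
  by apply: (subvP qg); rewrite memv_ker linearB /= qK subrr.
have uP : is_bimod_morphism (g \o q^-1)%VF.
  split=> x z; rewrite !comp_lfunE.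
    by rewrite -{1}[z]qK -bimod_hom_lact gK bimod_hom_lact.
  by rewrite -{1}[z]qK -bimod_hom_ract gK bimod_hom_ract.
exists (mk_hom uP); apply: bimod_hom_ext => z.
by rewrite comp_homE comp_lfunE gK.
Qed.

(** The inverse is the lift of the identity of [Y] through [f]; cancelling the injective [f] gives
    the other composite. *)
Lemma bimod_bij_iso X Y (f : bimod_hom X Y) :
  lker f = 0%VS -> limg f = fullv -> @iso F C X Y f.
Proof.
move=> f0 ff; have [|u fu] := @lift_mono X Y Y f (@idm F C Y) f0.
  by rewrite ff subvf.
exists u; split=> //; apply: bimod_hom_ext => x.
apply: (elimT lker0P (introT eqP f0)).
rewrite comp_homE id_homE.
have := congr1 (fun h : bimod_hom Y Y => h (f x)) fu.
by rewrite comp_homE id_homE.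
Qed.

(** The inclusion of the kernel and the zero map have the same composite with [f], so they agree. *)
Lemma bimod_mono_lker X Y (f : bimod_hom X Y) :
  @mono F C X Y f -> lker f = 0%VS.
Proof.
move=> f_mono; have [K [k [_ kf]]] := stable_sub (lker_stable f).
have k0 : k = 0.
  apply: f_mono; apply: bimod_hom_ext => z.
  rewrite !comp_homE bimod_hom0E linear0; apply/eqP.
  by rewrite -memv_ker -kf memv_img ?memvf.
rewrite -kf k0; apply/eqP; rewrite -subv0; apply/subvP=> y /memv_imgP[z _ ->].
by rewrite bimod_hom0E memv0.
Qed.

(** Dually, the projection onto the quotient by the image of [f] has the same composite with [f] as
    the zero map. *)
Lemma bimod_epi_limg X Y (f : bimod_hom X Y) :
  (forall Z (u v : bimod_hom Y Z),
     (u : mor (c := C) Y Z) \oc f = (v : mor (c := C) Y Z) \oc f -> u = v) ->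
  limg f = fullv.
Proof.
move=> f_epi; have [Q [q [_ qf]]] := stable_quotient (limg_stable f).
have q0 : q = 0.
  apply: f_epi; apply: bimod_hom_ext => x; rewrite !comp_homE bimod_hom0E.
  by apply/eqP; rewrite -memv_ker qf memv_img ?memvf.
by apply/vspaceP=> y; rewrite -qf q0 memvf memv_ker bimod_hom0E eqxx.
Qed.

Lemma bimod_comp0 X Y Z (g : bimod_hom Y Z) (f : bimod_hom X Y) :
  (g : mor (c := C) Y Z) \oc f = 0 <-> (limg f <= lker g)%VS.
Proof.
split=> [gf|fg].
  apply/subvP=> y /memv_imgP[x _ ->]; rewrite memv_ker.
  by rewrite -comp_homE gf bimod_hom0E.
apply: bimod_hom_ext => x; rewrite comp_homE bimod_hom0E; apply/eqP.
by rewrite -memv_ker; apply: (subvP fg); rewrite memv_img ?memvf.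
Qed.

Lemma bimod_kernelP K X Y (k : bimod_hom K X) (f : bimod_hom X Y) :
  @is_kernel F C K X Y k f <-> lker k = 0%VS /\ limg k = lker f.
Proof.
split=> [[fk0 univ]|[k0 kf]].
  have kf := (bimod_comp0 f k).1 fk0; split.
    apply: bimod_mono_lker => Z g h kgh.
    have [|u [_ uniq]] := univ Z ((k : mor (c := C) K X) \oc g).
      by apply/bimod_comp0/(subv_trans _ kf); rewrite limg_comp limgS ?subvf.
    by rewrite -(uniq g erefl) (uniq h).
  apply/eqP; rewrite eqEsubv kf /=.
  (* The universal property is tested on the inclusion of [lker f]: it factors through [k], whence
     [lker f] lies in the image of [k]. *)
  have [Z [i [_ iE]]] := stable_sub (lker_stable f).
  have [|u [iu _]] := univ Z i; first by apply/bimod_comp0; rewrite iE.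
  by rewrite -iE -iu limg_comp limgS ?subvf.
split=> [|Z g gf]; first by apply/bimod_comp0; rewrite kf.
have [|u ku] := lift_mono (g := g) k0; first by rewrite kf; apply/bimod_comp0.
exists u; split=> // v kv; apply: bimod_hom_ext => z.
by apply: (elimT lker0P (introT eqP k0)); rewrite -!comp_homE ku kv.
Qed.

Lemma bimod_cokernelP X Y Q (f : bimod_hom X Y) (q : bimod_hom Y Q) :
  @is_cokernel F C X Y Q f q <-> limg q = fullv /\ lker q = limg f.
Proof.
split=> [[qf0 univ]|[qf kq]].
  have fq := (bimod_comp0 q f).1 qf0; split.
    apply: bimod_epi_limg => Z g h gh.
    have [|u [_ uniq]] := univ Z ((g : mor (c := C) Q Z) \oc q).
      apply/bimod_comp0/subvP=> y /(subvP fq); rewrite !memv_ker comp_homE.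
      by move=> /eqP ->; rewrite linear0.
    by rewrite -(uniq g erefl) (uniq h).
  apply/eqP; rewrite eqEsubv fq andbT.
  (* The projection modulo [limg f] factors through [q], so its kernel [limg f] contains
     [lker q]. *)
  have [Z [p [_ pE]]] := stable_quotient (limg_stable f).
  have [|u [up _]] := univ Z p; first by apply/bimod_comp0; rewrite pE.
  rewrite -pE -up; apply/subvP=> y; rewrite !memv_ker comp_homE.
  by move=> /eqP ->; rewrite linear0.
split=> [|Z g gf]; first by apply/bimod_comp0; rewrite kq.
have [|u uq] := lift_epi (g := g) qf; first by rewrite kq; apply/bimod_comp0.
exists u; split=> // v vq; apply: bimod_hom_ext => z.
have /memv_imgP[y _ ->] : z \in limg q by rewrite qf memvf.
by rewrite -!comp_homE uq vq.
Qed.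

Lemma wbimod_abelian : is_abelian C.
Proof.
move=> X Y f.
have [K [k [k0 kf]]] := stable_sub (lker_stable f).
have [I [j [j0 jf]]] := stable_sub (limg_stable f).
have [Q [c [cf kc]]] := stable_quotient (limg_stable f).
(* The morphism [i] is [f] corestricted to its image; it has the kernel of [f] and is surjective. *)
have [|i ji] := lift_mono (g := f) j0; first by rewrite jf.
have j_inj : injective j by apply/lker0P/eqP.
exists K, I, Q, k, i, j, c; split=> //.
- by apply/bimod_kernelP.
- by apply/bimod_cokernelP.
- apply/bimod_cokernelP; split; apply/vspaceP=> z.
    rewrite memvf; have: j z \in limg f by rewrite -jf memv_img ?memvf.
    case/memv_imgP=> x _ jz; apply/memv_imgP; exists x; rewrite ?memvf //.
    by apply: j_inj; rewrite jz -ji comp_homE.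
  rewrite kf !memv_ker -ji comp_homE; apply/eqP/eqP => [->|jiz].
    by rewrite linear0.
  by apply: j_inj; rewrite jiz linear0.
- by apply/bimod_kernelP; rewrite kc jf.
Qed.

End Bimodules.

(** * Zero object, simple quotients and composition series *)

Section FiniteLength.
Variables (F : fieldType) (L : leibnizType F).
Implicit Types M N K X Y Z Q : wbimodType L.
Local Notation C := (wbimod_cat L).

Lemma bimod_zeroP X : @zero_object F C X <-> fullv = 0%VS :> {vspace X}.
Proof.
split=> [X0|X0 Y].
  apply/eqP; rewrite -subv0; apply/subvP=> x _; rewrite memv0.
  by rewrite -[x]id_homE ((X0 X).1 (idm _)) bimod_hom0E.
have x0 (x : X) : x = 0 by apply/eqP; rewrite -memv0 -X0 memvf.
split=> f; apply: bimod_hom_ext => y; rewrite bimod_hom0E; last exact: x0.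
by rewrite (x0 y) linear0.
Qed.

Lemma stable0 M : stable (0 : {vspace M}).
Proof.
by move=> x m; rewrite !memv0 => /eqP ->; rewrite linear0r linear0l eqxx.
Qed.

Lemma wbimod_zero : exists X, @zero_object F C X.
Proof.
have [K [k [k0 kim]]] := stable_sub (@stable0 (unit_bimod L)).
exists K; apply/bimod_zeroP/eqP; rewrite -subv0 -k0; apply/subvP=> x _.
by rewrite memv_ker -memv0 -kim memv_img ?memvf.
Qed.

(** A proper stable subspace of largest dimension works; such subspaces exist because the zero
    subspace is one. *)
Lemma exists_maximal_stable M : fullv != 0%VS :> {vspace M} ->
  exists U : {vspace M}, [/\ stable U, U != fullv
    & forall W : {vspace M}, stable W -> (U <= W)%VS -> W = U \/ W = fullv].
Proof.
move=> M0; pose P n :=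
  `[< exists U : {vspace M}, [/\ stable U, U != fullv & \dim U = n] >].
have exP : exists n, P n.
  exists 0%N; apply/asboolP; exists 0%VS; rewrite dimv0 eq_sym.
  by split=> //; apply: stable0.
have bP n : P n -> (n <= \dim {:M})%N.
  by move=> /asboolP[U [_ _ <-]]; rewrite dimvS ?subvf.
case: (ex_maxnP exP bP) => n /asboolP[U [sU Uf dU]] maxn.
exists U; split=> // W sW UW; have [->|Wf] := eqVneq W fullv; [by right|left].
apply/eqP; rewrite eq_sym eqEdim UW dU; apply: maxn.
by apply/asboolP; exists W.
Qed.

Lemma bimod_short_exactP X Y Z (f : bimod_hom X Y) (g : bimod_hom Y Z) :
  @short_exact F C X Y Z f g <->
  [/\ lker f = 0%VS, limg f = lker g & limg g = fullv].
Proof.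
split=> [[/bimod_kernelP[f0 fg] /bimod_cokernelP[gf _]] //|[f0 fg gf]].
by split; [apply/bimod_kernelP | apply/bimod_cokernelP].
Qed.

(** A subobject of [Q] pulls back to a stable subspace containing [U], hence to [U] or to all of
    [M]. In the first case its image under [f] is zero, in the second [f] is bijective. *)
Lemma simple_quotient M Q (U : {vspace M}) (q : bimod_hom M Q) :
    U != fullv -> limg q = fullv -> lker q = U ->
    (forall W : {vspace M}, stable W -> (U <= W)%VS -> W = U \/ W = fullv) ->
  @simple_object F C Q.
Proof.
move=> Uf qf qU maxU; split=> [/bimod_zeroP Q0|Y f /bimod_mono_lker f0].
  case/eqP: Uf; apply/vspaceP=> m; rewrite -qU memv_ker memvf -memv0.
  by rewrite -Q0 memvf.
have qW : (q @: (q @^-1: limg f))%VS = limg f.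
  by rewrite lpreimK // qf subvf.
have [||WU|Wf] := maxU (q @^-1: limg f)%VS.
- exact/lpreim_stable/limg_stable.
- apply/subvP=> m; rewrite -qU memv_ker -memv_preim => /eqP ->; exact: mem0v.
- left; apply/bimod_zeroP/eqP; rewrite -subv0 -f0; apply/subvP=> y _.
  have : f y \in limg f by rewrite memv_img ?memvf.
  rewrite -qW WU -qU => /memv_imgP[m]; rewrite memv_ker => /eqP qm fy.
  by rewrite memv_ker fy qm.
- by right; apply: bimod_bij_iso => //; rewrite -qW Wf.
Qed.

Lemma wbimod_finite_length X : @finite_length F C X.
Proof.
(* Induction on a strict bound [n] for the dimension, so that the case [n = 0] is vacuous. *)
move: {2}_.+1 (ltnSn (\dim {:X})) => n; elim: n X => // n IHn X dX.
have [X0|X0] := eqVneq (fullv : {vspace X}) 0%VS.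
  exact/FiniteLength0/bimod_zeroP.
have [U [sU Uf maxU]] := exists_maximal_stable X0.
have [K [k [k0 kU]]] := stable_sub sU.
have [Q [q [qf qU]]] := stable_quotient sU.
apply: (@FiniteLengthS F C K X Q k q).
(* As [k] is injective with image [U], the dimension of [K] is that of the proper subspace [U]. *)
- apply: IHn; rewrite -(limg_dim_eq (f := bimod_lfun k)) ?k0 ?capv0 // kU.
  apply: (leq_trans _ (dX : \dim {:X} <= n)%N).
  rewrite ltn_neqAle dimvS ?subvf // andbT.
  by apply: contraNneq Uf => dU; rewrite eqEdim subvf dU leqnn.
- by apply/bimod_short_exactP; rewrite kU qU.
- exact: simple_quotient Uf qf qU maxU.
Qed.

End FiniteLength.

(** * Finite-dimensional Hom spaces and the linear structure *)

Lemma finite_dimensional_sub (F : fieldType) (V : lmodType F) (W : vectType F)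
    (f : V -> W) : linear f -> injective f -> finite_dimensional V.
Proof.
move=> lf f_inj.
(* [U] will be a subspace of largest dimension inside the image of [f]; it turns out to be the whole
   image. *)
pose P (n : nat) := `[< exists U : {vspace W},
  (forall w, w \in U -> exists v, w = f v) /\ \dim U = n >].
have f0 : f 0 = 0 by have := lf (-1) 0 0; rewrite scaler0 addr0 scaleN1r addNr.
have exP : exists n, P n.
  exists 0%N; apply/asboolP; exists 0%VS; rewrite dimv0; split=> // w.
  by rewrite memv0 => /eqP ->; exists 0.
have bP n : P n -> (n <= \dim {:W})%N.
  by move=> /asboolP[U [_ <-]]; rewrite dimvS ?subvf.
case: (ex_maxnP exP bP) => n /asboolP[U [Uf dU]] maxn.
have fU v : f v \in U.
  (* Adding the line of [f v] to [U] stays inside the image, so maximality forces [f v] into [U]. *)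
  have: (\dim (U + <[f v]>)%VS <= \dim U)%N.
    rewrite dU; apply: maxn; apply/asboolP; exists (U + <[f v]>)%VS.
    split=> // w.
    case/memv_addP=> u /Uf[u' ->] [_ /vlineP[a ->] ->].
    by exists (a *: v + u'); rewrite lf addrC.
  rewrite (geq_leqif (dimv_leqif_sup (addvSl U <[f v]>%VS))) subv_add.
  by move=> /andP[_]; rewrite -memvE.
pose g v := v2r (vsproj U (f v)).
exists (dim (subvs_of U)); split; exists g.
  by move=> a u v; rewrite /g lf !linearP.
have g_inj : injective g.
  move=> u v /v2r_inj /(congr1 val); rewrite /= !vsprojK //; exact: f_inj.
have /choice[h hK] r : exists v, g v = r.
  have [v fv] := Uf _ (subvsP (r2v r)); exists v.
  by rewrite /g -fv vsvalK r2vK.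
exists h => [v|r]; last exact: hK.
by apply: g_inj; rewrite hK.
Qed.

Section Linear.
Variables (F : fieldType) (L : leibnizType F).
Implicit Types M N K X Y Z Q : wbimodType L.
Local Notation C := (wbimod_cat L).

Lemma wbimod_locally_finite : locally_finite C.
Proof.
split=> [X Y|X]; last exact: wbimod_finite_length.
apply: (@finite_dimensional_sub _ _ _ (@bimod_lfun F L X Y)).
  by move=> a f g; apply/lfunP=> x; rewrite bimod_homPE.
exact: val_inj.
Qed.

Lemma wbimod_category : is_category C.
Proof.
split=> *; apply: bimod_hom_ext => x.
- by rewrite comp_homE id_homE.
- by rewrite comp_homE id_homE.
- by rewrite !comp_homE.
Qed.

Lemma wbimod_comp_bilinear : bilinear_comp C.
Proof.
move=> X Y Z; split=> [f|g] a u v; apply: bimod_hom_ext => x.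
  by rewrite bimod_homPE !comp_homE bimod_homPE.
by rewrite bimod_homPE !comp_homE bimod_homPE linearP.
Qed.

Section Prod.
Variables M N : wbimodType L.

Definition prod_lact (x : L) (u : M * N) : M * N := (lact x u.1, lact x u.2).
Definition prod_ract (u : M * N) (x : L) : M * N := (ract u.1 x, ract u.2 x).

Lemma prod_lact_bilinear : bilinear_for *:%R *:%R prod_lact.
Proof.
by split=> [u|x] a v w; rewrite /prod_lact ?linearPl ?linearPr.
Qed.

Lemma prod_ract_bilinear : bilinear_for *:%R *:%R prod_ract.
Proof.
by split=> [x|u] a v w; rewrite /prod_ract ?linearPl ?linearPr.
Qed.

Lemma prod_LLM (x y : L) (u : M * N) :
  prod_lact (leibmul x y) u
  = prod_lact x (prod_lact y u) - prod_lact y (prod_lact x u).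
Proof. by rewrite /prod_lact !lact_LLM. Qed.

Lemma prod_LML (x y : L) (u : M * N) :
  prod_ract (prod_lact x u) y
  = prod_lact x (prod_ract u y) - prod_ract u (leibmul x y).
Proof. by rewrite /prod_lact /prod_ract !ract_LML. Qed.

HB.instance Definition _ := isWeakBimod.Build F L (M * N)%type
  prod_lact_bilinear prod_ract_bilinear prod_LLM prod_LML.

End Prod.

Lemma wbimod_biproduct X1 X2 : exists Y, @biproduct F C X1 X2 Y.
Proof.
pose Y : wbimodType L := (X1 * X2)%type.
have [p1 p1E] := linear_lfun (V := Y) (W := X1) (f := fst) (fun a u v => erefl).
have [p2 p2E] := linear_lfun (V := Y) (W := X2) (f := snd) (fun a u v => erefl).
have l1 : linear (fun u : X1 => (u, 0) : Y).
  by move=> a u v; congr pair; rewrite /= scaler0 addr0.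
have l2 : linear (fun u : X2 => (0, u) : Y).
  by move=> a u v; congr pair; rewrite /= scaler0 addr0.
have [i1 i1E] := linear_lfun l1; have [i2 i2E] := linear_lfun l2.
have p1P : @is_bimod_morphism F L Y X1 p1 by split=> x u; rewrite !p1E.
have p2P : @is_bimod_morphism F L Y X2 p2 by split=> x u; rewrite !p2E.
have i1P : @is_bimod_morphism F L X1 Y i1.
  by split=> x u; rewrite !i1E; congr pair; rewrite ?linear0r ?linear0l.
have i2P : @is_bimod_morphism F L X2 Y i2.
  by split=> x u; rewrite !i2E; congr pair; rewrite ?linear0r ?linear0l.
exists Y, (mk_hom p1P), (mk_hom p2P), (mk_hom i1P), (mk_hom i2P).
split; apply: bimod_hom_ext => u.
- by rewrite comp_homE id_homE /= p1E i1E.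
- by rewrite comp_homE id_homE /= p2E i2E.
(* The factor 1 brings the sum to the shape [a *: f + g] expected by [bimod_homPE]. *)
- rewrite -[X in X + _]scale1r bimod_homPE !comp_homE id_homE scale1r /=.
  rewrite i1E i2E p1E p2E; case: u => u v; congr pair => /=.
    exact: addr0.
  exact: add0r.
Qed.

Lemma wbimod_linear : is_linear_category C.
Proof.
split; [exact: wbimod_category | exact: wbimod_comp_bilinear
  | exact: wbimod_zero | exact: wbimod_biproduct].
Qed.

End Linear.

(** * Tensor products of linear maps, and split exact sequences *)

Section TensorSpaces.
Variable F : fieldType.
Implicit Types V W X U : vectType F.

Lemma tens_ext3r V W X U (f g : 'Hom(tensor V (tensor W X), U)) :
  (forall v w x, f (tens v (tens w x)) = g (tens v (tens w x))) -> f = g.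
Proof.
move=> fg; apply: tens_ext => v t.
have lin : linear (fun s : tensor W X => tens v s).
  by move=> a s s'; rewrite linearPr.
have [h hE] := linear_lfun lin.
suff /lfunP/(_ t): (f \o h)%VF = (g \o h)%VF by rewrite !comp_lfunE hE.
by apply: tens_ext => w x; rewrite !comp_lfunE hE fg.
Qed.

Lemma tens_ext4 V W X Y U (f g : 'Hom(tensor (tensor (tensor V W) X) Y, U)) :
  (forall v w x y, f (tens (tens (tens v w) x) y)
                   = g (tens (tens (tens v w) x) y)) -> f = g.
Proof.
move=> fg; apply: tens_ext => t y.
have lin : linear (fun s : tensor (tensor V W) X => tens s y).
  by move=> a s s'; rewrite linearPl.
have [h hE] := linear_lfun lin.
suff /lfunP/(_ t): (f \o h)%VF = (g \o h)%VF by rewrite !comp_lfunE hE.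
by apply: tens_ext3 => v w x; rewrite !comp_lfunE hE fg.
Qed.

Lemma tens_map_id V W : tens_map (\1 : 'End(V)) (\1 : 'End(W)) = \1%VF.
Proof. by apply: tens_ext => v w; rewrite tens_mapE !id_lfunE. Qed.

Lemma tens_map_comp V V' V'' W W' W'' (f' : 'Hom(V', V'')) (f : 'Hom(V, V'))
    (g' : 'Hom(W', W'')) (g : 'Hom(W, W')) :
  tens_map (f' \o f)%VF (g' \o g)%VF = (tens_map f' g' \o tens_map f g)%VF.
Proof.
by apply: tens_ext => v w; rewrite comp_lfunE !tens_mapE !comp_lfunE.
Qed.

Lemma tens_map_bilinear V V' W W' :
  bilinear_for *:%R *:%R
    (fun (f : 'Hom(V, V')) (g : 'Hom(W, W')) => tens_map f g).
Proof.
split=> [g|f] a u v; apply: tens_ext => x y.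
  by rewrite add_lfunE scale_lfunE !tens_mapE add_lfunE scale_lfunE linearPl.
by rewrite add_lfunE scale_lfunE !tens_mapE add_lfunE scale_lfunE linearPr.
Qed.

(** Makes the generic bilinearity rules apply to [tens_map], as needed for the sum in a
    splitting. *)
HB.instance Definition _ V V' W W' :=
  bilinear_isBilinear.Build F 'Hom(V, V') 'Hom(W, W')
    'Hom(tensor V W, tensor V' W') *:%R *:%R (@tens_map F V V' W W')
    (tens_map_bilinear V V' W W').

(** Serves to obtain the inverse associator from [tens_assoc] by permuting factors. *)
Definition tens_swap V W : 'Hom(tensor V W, tensor W V) :=
  tens_lift (fun v w => tens w v).

Lemma tens_swapE V W (v : V) (w : W) : tens_swap V W (tens v w) = tens w v.
Proof.
rewrite /tens_swap tens_lift_bilinear //.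
by split=> [w'|v'] a x y; rewrite !(linearPl, linearPr).
Qed.

(* u (v w) |-> (v w) u |-> (w v) u |-> w (v u) |-> (v u) w |-> (u v) w *)
Definition tens_assoc_inv V W X :
    'Hom(tensor V (tensor W X), tensor (tensor V W) X) :=
  (tens_map (tens_swap W V) \1 \o tens_swap X (tensor W V)
   \o tens_assoc X W V \o tens_map (tens_swap W X) \1
   \o tens_swap V (tensor W X))%VF.

Lemma tens_assoc_invE V W X (v : V) (w : W) (x : X) :
  tens_assoc_inv V W X (tens v (tens w x)) = tens (tens v w) x.
Proof.
by rewrite !comp_lfunE !(tens_swapE, tens_mapE, id_lfunE, tens_assocE).
Qed.

Lemma tens_assoc_pentagon V W X Y :
  (tens_assoc V W (tensor X Y) \o tens_assoc (tensor V W) X Y)%VF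
  = (tens_map \1 (tens_assoc W X Y) \o tens_assoc V (tensor W X) Y
     \o tens_map (tens_assoc V W X) \1)%VF.
Proof.
apply: tens_ext4 => v w x y.
by rewrite !comp_lfunE /= !(tens_mapE, tens_assocE, id_lfunE).
Qed.

Lemma split_exact V W X (f : 'Hom(V, W)) (g : 'Hom(W, X)) :
  lker f = 0%VS -> limg f = lker g -> limg g = fullv ->
  exists (r : 'Hom(W, V)) (s : 'Hom(X, W)),
    [/\ (r \o f = \1)%VF, (g \o s = \1)%VF & ((f \o r) + (s \o g) = \1)%VF].
Proof.
move=> f0 fg gf.
have gK x : g (g^-1%VF x) = x by apply: limg_lfunVK; rewrite gf memvf.
have fK w : w \in limg f -> f (f^-1%VF w) = w by exact: limg_lfunVK.
have gf0 v : g (f v) = 0.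
  by apply/eqP; rewrite -memv_ker -fg memv_img ?memvf.
pose s := (g^-1)%VF.
(* The vector [w - s (g w)] lies in [lker g], which is the image of [f], so [f^-1] inverts [f]
   there. *)
have [r rE] : exists r : 'Hom(W, V), forall w, r w = (f^-1)%VF (w - s (g w)).
  exists (f^-1 \o (\1 - (s \o g)))%VF => w.
  by rewrite comp_lfunE add_lfunE opp_lfunE id_lfunE comp_lfunE.
exists r, s; split; apply/lfunP=> w; rewrite ?add_lfunE !comp_lfunE id_lfunE //.
  by rewrite rE gf0 linear0 subr0 lker0_lfunK ?f0.
by rewrite rE fK ?subrK // fg memv_ker linearB /= gK subrr.
Qed.

(** Converse of [split_exact]. Its hypotheses are equations between sums of composites, so tensoring
    with a fixed space preserves them. *)
Lemma exact_split V W X (f : 'Hom(V, W)) (g : 'Hom(W, X))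
    (r : 'Hom(W, V)) (s : 'Hom(X, W)) :
  (r \o f = \1)%VF -> (g \o s = \1)%VF -> ((f \o r) + (s \o g) = \1)%VF ->
  (g \o f = 0)%VF ->
  [/\ lker f = 0%VS, limg f = lker g & limg g = fullv].
Proof.
move=> /lfunP rf /lfunP gs /lfunP fr_sg /lfunP gf; split; apply/vspaceP=> x.
- rewrite memv_ker memv0; apply/eqP/eqP => [fx|->]; last exact: linear0.
  by have := rf x; rewrite comp_lfunE id_lfunE fx linear0.
- rewrite memv_ker; apply/memv_imgP/eqP => [[v _ ->]|gx].
    by have := gf v; rewrite comp_lfunE zero_lfunE.
  exists (r x); rewrite ?memvf //; have := fr_sg x.
  by rewrite add_lfunE !comp_lfunE gx linear0 addr0 id_lfunE.
- rewrite memvf; apply/memv_imgP; exists (s x); rewrite ?memvf //.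
  by have := gs x; rewrite comp_lfunE id_lfunE.
Qed.

End TensorSpaces.

(** * Monoidal axioms, biexactness and endomorphisms of the unit *)

Section Monoidal.
Variables (F : fieldType) (L : leibnizType F).
Implicit Types M N K X Y Z Q : wbimodType L.
Local Notation C := (wbimod_cat L).
Local Notation D := (wbimod_monoidal L).

(** For the structural isomorphisms: a merely linear two-sided inverse suffices, since it makes [f]
    bijective. *)
Lemma bimod_iso_can X Y (f : bimod_hom X Y) (g : 'Hom(Y, X)) :
  (g \o f = \1)%VF -> (f \o g = \1)%VF -> @iso F C X Y f.
Proof.
move=> /lfunP gf /lfunP fg; apply: bimod_bij_iso; apply/vspaceP=> x.
  rewrite memv_ker memv0; apply/eqP/eqP => [fx|->]; last exact: linear0.
  by have := gf x; rewrite comp_lfunE id_lfunE fx linear0.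
rewrite memvf; apply/memv_imgP; exists (g x); rewrite ?memvf //.
by have := fg x; rewrite comp_lfunE id_lfunE.
Qed.

Lemma wbimod_is_monoidal : is_monoidal D.
Proof.
split.
- by move=> X Y; apply/val_inj/tens_map_id.
- by move=> *; apply/val_inj/tens_map_comp.
- move=> X Y Z; apply: (@bimod_iso_can _ _ _ (tens_assoc_inv X Y Z)).
    apply: tens_ext3 => x y z.
    by rewrite comp_lfunE tens_assocE tens_assoc_invE id_lfunE.
  apply: tens_ext3r => x y z.
  by rewrite comp_lfunE tens_assoc_invE tens_assocE id_lfunE.
- move=> X X' Y Y' Z Z' f g h; apply/val_inj/tens_ext3 => x y z.
  by rewrite !comp_lfunE /= !(tens_mapE, tens_assocE).
- move=> X.
  have lin : linear (fun x : X => tens (1 : unit_bimod L) x).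
    by move=> a u v; rewrite linearPr.
  have [h hE] := linear_lfun lin.
  apply: (@bimod_iso_can _ _ _ h); last first.
    by apply/lfunP=> x; rewrite comp_lfunE hE tens_lunitE scale1r id_lfunE.
  apply: (@tens_ext F (unit_bimod L) X) => a x.
  (* The scalar [a] moves from the right factor to the left one, where it multiplies 1. *)
  rewrite comp_lfunE tens_lunitE hE linearZr_LR -linearZl_LR id_lfunE.
  by congr tens; exact: mulr1.
- move=> X Y f; apply/val_inj/(@tens_ext F (unit_bimod L) X) => a x.
  by rewrite !comp_lfunE /= tens_mapE !tens_lunitE id_lfunE linearZ.
- move=> X.
  have lin : linear (fun x : X => tens x (1 : unit_bimod L)).
    by move=> a u v; rewrite linearPl.
  have [h hE] := linear_lfun lin.
  apply: (@bimod_iso_can _ _ _ h); last first.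
    by apply/lfunP=> x; rewrite comp_lfunE hE tens_runitE scale1r id_lfunE.
  apply: (@tens_ext F X (unit_bimod L)) => x a.
  rewrite comp_lfunE tens_runitE hE linearZl_LR -linearZr_LR id_lfunE.
  by congr tens; exact: mulr1.
- move=> X Y f; apply/val_inj/(@tens_ext F X (unit_bimod L)) => x a.
  by rewrite !comp_lfunE /= tens_mapE !tens_runitE id_lfunE linearZ.
- by move=> X Y Z W; apply/val_inj/tens_assoc_pentagon.
- move=> X Y; apply/val_inj/(@tens_ext3 F X (unit_bimod L) Y) => x a y.
  rewrite !comp_lfunE /= !(tens_mapE, tens_assocE, id_lfunE).
  by rewrite tens_lunitE tens_runitE linearZr_LR linearZl_LR.
Qed.

Lemma wbimod_bilinear_tensor : bilinear_tensor D.
Proof.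
move=> X X' Y Y'; have [bl br] := tens_map_bilinear X X' Y Y'.
split=> [g|f] a u v; apply: bimod_hom_ext => t; rewrite bimod_homPE /=.
  by rewrite [tens_map _ _]bl add_lfunE scale_lfunE.
by rewrite [tens_map _ _]br add_lfunE scale_lfunE.
Qed.

Lemma wbimod_biexact_tensor : biexact_tensor D.
Proof.
move=> W X Y Z f g /bimod_short_exactP[f0 fg gf].
(* The maps [r] and [s] are only linear, which is enough because exactness concerns the underlying
   linear maps. *)
have [r [s [rf gs fr_sg]]] := split_exact f0 fg gf.
have gf0 : (bimod_lfun g \o bimod_lfun f)%VF = 0.
  by apply: (congr1 val ((bimod_comp0 g f).2 _)); rewrite fg.
split; apply/bimod_short_exactP.
  apply: (exact_split (r := tens_map \1%VF r) (s := tens_map \1%VF s)).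
  - by rewrite -tens_map_comp comp_lfun1l rf tens_map_id.
  - by rewrite -tens_map_comp comp_lfun1l gs tens_map_id.
  - by rewrite -!tens_map_comp comp_lfun1l -linearDr /= fr_sg tens_map_id.
  - by rewrite -tens_map_comp comp_lfun1l gf0 linear0r.
apply: (exact_split (r := tens_map r \1%VF) (s := tens_map s \1%VF)).
- by rewrite -tens_map_comp comp_lfun1l rf tens_map_id.
- by rewrite -tens_map_comp comp_lfun1l gs tens_map_id.
- by rewrite -!tens_map_comp comp_lfun1l -linearDl /= fr_sg tens_map_id.
- by rewrite -tens_map_comp comp_lfun1l gf0 linear0l.
Qed.

(** The isomorphism is evaluation at 1; its inverse sends [a] to multiplication by [a]. *)
Lemma wbimod_unit_endo : unit_endo_trivial D.
Proof.
pose U : wbimodType L := unit_bimod L; pose e : U := 1.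
have lin a : linear (fun u : U => (u : F^o) * a : U).
  by move=> b u v; rewrite mulrDl -mulrA.
have fE (f : bimod_hom U U) (a : F) :
    bimod_lfun f (a : U) = a * (bimod_lfun f e : F^o).
  by rewrite -[X in bimod_lfun f X](mulr1 a) -[a * 1]/(a *: e) linearZ.
exists (fun f : bimod_hom U U => bimod_lfun f e : F^o); split.
- by move=> a f g; rewrite bimod_homPE.
- have /choice[h hE] (a : F^o) : exists f : bimod_hom U U,
      forall u : U, bimod_lfun f u = (u : F^o) * a.
    have [f fM] := linear_lfun (lin a).
    have fP : @is_bimod_morphism F L U U f.
      (* Both actions on the unit bimodule vanish, so every linear endomorphism is a morphism. *)
      by split=> x u; rewrite linear0.
    by exists (mk_hom fP).
  exists h => [f|a]; last by rewrite hE mul1r.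
  by apply: bimod_hom_ext => u; rewrite hE -fE.
- rewrite id_homE; reflexivity.
(* Evaluating the composite gives [g 1] times [f 1]; commutativity of [F] restores the order. *)
- move=> f g; rewrite comp_homE [LHS](fE f (bimod_lfun g e)); exact: mulrC.
Qed.

End Monoidal.

Theorem theorem3p26 (F : fieldType) (L : leibnizType F) :
  is_ring_category (wbimod_monoidal L).
Proof.
split.
- exact: wbimod_linear.
- exact: wbimod_abelian.
- exact: wbimod_locally_finite.
- exact: wbimod_is_monoidal.
- exact: wbimod_bilinear_tensor.
- exact: wbimod_biexact_tensor.
- exact: wbimod_unit_endo.
Qed.
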